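(* Let $m\ge 2$ be an integer. The semigroup $S_{J_m}$ is a monoid (with identity $e$), and it has the monoid presentation $$S_{J_m}=\langle\, e,f_0,f_1 \mid R_A(k,p),\ R_B(k),\ k\ge 0,\ p=1,2,\ldots,m-1\,\rangle ,$$ where $R_A(k,p)$ is the relation $$f_0 f_1^{p m^k-1}\cdot f_0 f_1^{m^k-1} f_0\cdots f_1^{m^2-1} f_0 f_1^{m-1} f_0 = f_0 f_1^{m^k-1} f_0\cdots f_1^{m^2-1} f_0 f_1^{m-1} f_0$$ and $R_B(k)$ is the relation $$f_0 f_1^{m^k-1}\cdot f_1^{m^{k+1}} f_0 f_1^{m^k-1} f_0\cdots f_1^{m^2-1} f_0 f_1^{m-1} f_0 = f_1^{m^{k+1}} f_0 f_1^{m^k-1} f_0\cdots f_1^{m^2-1} f_0 f_1^{m-1} f_0 .$$ The monoid $S_{J_m}$ is infinitely presented (it has no finite presentation), and the word problem in $S_{J_m}$ may be solved in no more than quadratic time.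
   Context: Let $X_m=\{x_0,\ldots,x_{m-1}\}$ and let $X_m^\omega$ be the set of right-infinite words over $X_m$. $J_m$ is the Mealy automaton over $X_m$ with three states $e,f_0,f_1$, which define the following transformations of $X_m^\omega$ (for all $w\in X_m^\omega$): $e$ is the identity; $f_0(x_i w)=x_0 w$ for $0\le i\le m-2$ and $f_0(x_{m-1}w)=x_0 f_0(w)$; $f_1(x_i w)=x_{i+1}w$ for $0\le i\le m-2$ and $f_1(x_{m-1}w)=x_0 f_1(w)$. $S_{J_m}$ is the semigroup of transformations of $X_m^\omega$ generated by $e,f_0,f_1$ under composition; products act from right to left, $(fg)(u)=f(g(u))$, and $f^0=e$. In the presentation $e$ denotes the identity element. Writing $v_k=f_0 f_1^{m^k-1}f_0 f_1^{m^{k-1}-1}\cdots f_0 f_1^{m-1}f_0$ with $v_0=f_0$, the relations read $R_A(k,p):\ f_0f_1^{pm^k-1}v_k=v_k$ and $R_B(k):\ f_0f_1^{m^k+m^{k+1}-1}v_k=f_1^{m^{k+1}}v_k$. The word problem asks, given two words over the generators, whether they represent the same element; time is measured in terms of the total length of the two words. *)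

(* Defs.v *)
From HB Require Import structures.
From mathcomp Require Import all_boot.
Set Implicit Arguments.
Unset Strict Implicit.
Unset Printing Implicit Defensive.

(** * Mealy automata acting on right-infinite words *)

(* [X^omega] is represented by [nat -> X]. *)
Definition omega (X : Type) : Type := nat -> X.

Definition ocons (X : Type) (x : X) (w : omega X) : omega X :=
  fun n => if n is n'.+1 then w n' else x.

Record mealy (X Q : Type) : Type := Mealy {
  mtrans : Q -> X -> Q;
  mout : Q -> X -> X
}.

Fixpoint mstate (X Q : Type) (M : mealy X Q) (q : Q) (w : omega X) (n : nat)
    : Q :=
  if n is n'.+1 then mtrans M (mstate M q w n') (w n') else q.

Definition maction (X Q : Type) (M : mealy X Q) (q : Q) : omega X -> omega X :=
  fun w n => mout M (mstate M q w n) (w n).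

Lemma maction_cons (X Q : Type) (M : mealy X Q) (q : Q) (x : X) (w : omega X) :
  maction M q (ocons x w) =1 ocons (mout M q x) (maction M (mtrans M q x) w).
Proof.
have st n : mstate M q (ocons x w) n.+1 = mstate M (mtrans M q x) w n.
  by elim: n => [|n /= ->].
by case=> [//|n]; rewrite /maction st.
Qed.

(** * The automaton [J_m] *)

Inductive jstate : Type := e_ | f0_ | f1_.

Definition jstate_code (q : jstate) : option bool :=
  match q with e_ => None | f0_ => Some false | f1_ => Some true end.
Definition jstate_decode (c : option bool) : jstate :=
  match c with None => e_ | Some false => f0_ | Some true => f1_ end.
Lemma jstate_codeK : cancel jstate_code jstate_decode. Proof. by case. Qed.
HB.instance Definition _ := Countable.copy jstate (can_type jstate_codeK).
HB.instance Definition _ : isFinite jstate := CanIsFinite jstate_codeK.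

(* The first letter [x_0], available as soon as the alphabet is inhabited. *)
Definition letter0 (m : nat) (i : 'I_m) : 'I_m :=
  Ordinal (leq_ltn_trans (leq0n i) (ltn_ord i)).

(* [ordS] is the cyclic successor: [x_i |-> x_(i+1)], [x_(m-1) |-> x_0]. *)
Definition J (m : nat) : mealy 'I_m jstate := Mealy
  (fun q (i : 'I_m) => if i.+1 == m then q else e_)
  (fun q (i : 'I_m) => match q with e_ => i | f0_ => letter0 i | f1_ => ordS i end).

Definition Jact (m : nat) (q : jstate) : omega 'I_m -> omega 'I_m :=
  maction (J m) q.

Lemma Jact_e (m : nat) (w : omega 'I_m) : Jact e_ w =1 w.
Proof.
have st n : mstate (J m) e_ w n = e_ by elim: n => [|n /= ->] //=; case: ifP.
by move=> n; rewrite /Jact /maction st.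
Qed.

Lemma Jact_f0_lt (m : nat) (i : 'I_m) (w : omega 'I_m) :
  i.+1 < m -> Jact f0_ (ocons i w) =1 ocons (letter0 i) w.
Proof.
move=> lt_im [|n]; rewrite /Jact maction_cons //= ltn_eqF //; exact: Jact_e.
Qed.

Lemma Jact_f0_last (m : nat) (i : 'I_m) (w : omega 'I_m) :
  i.+1 = m -> Jact f0_ (ocons i w) =1 ocons (letter0 i) (Jact f0_ w).
Proof. by move=> im [|n]; rewrite /Jact maction_cons //= im eqxx. Qed.

Lemma Jact_f1_lt (m : nat) (i j : 'I_m) (w : omega 'I_m) :
  i.+1 < m -> j = i.+1 :> nat -> Jact f1_ (ocons i w) =1 ocons j w.
Proof.
move=> lt_im ji [|n]; rewrite /Jact maction_cons /= ?ltn_eqF //; last first.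
  exact: Jact_e.
by apply: val_inj; rewrite /= modn_small.
Qed.

Lemma Jact_f1_last (m : nat) (i : 'I_m) (w : omega 'I_m) :
  i.+1 = m -> Jact f1_ (ocons i w) =1 ocons (letter0 i) (Jact f1_ w).
Proof.
move=> im [|n]; rewrite /Jact maction_cons /= ?im ?eqxx //.
by apply: val_inj; rewrite /= {1}im modnn.
Qed.

(** * Semigroups of transformations, presentations *)

(* A semigroup of transformations of [T] is given as a predicate on [T -> T];
   [f \o g] is the product [fg], acting from right to left. *)
Inductive generated (T I : Type) (phi : I -> T -> T) : (T -> T) -> Prop :=
| gen_base (i : I) : generated phi (phi i)
| gen_comp (f g : T -> T) :
    generated phi f -> generated phi g -> generated phi (f \o g).

Definition SJ (m : nat) : (omega 'I_m -> omega 'I_m) -> Prop :=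
  generated (@Jact m).

Definition is_monoid_with_identity (T : Type) (S : (T -> T) -> Prop)
    (u : T -> T) : Prop :=
  [/\ forall f g : T -> T, S f -> S g -> S (f \o g),
      S u &
      forall f : T -> T, S f -> u \o f = f /\ f \o u = f].

Definition weval (T A : Type) (phi : A -> T -> T) (w : seq A) : T -> T :=
  foldr (fun a f => phi a \o f) id w.

(* The congruence on the free monoid [seq A] generated by [R]. *)
Inductive congr_closure (A : Type) (R : seq A -> seq A -> Prop) :
    seq A -> seq A -> Prop :=
| cc_rel (x l r y : seq A) :
    R l r -> congr_closure R (x ++ l ++ y) (x ++ r ++ y)
| cc_refl (u : seq A) : congr_closure R u u
| cc_sym (u v : seq A) : congr_closure R u v -> congr_closure R v u
| cc_trans (u v w : seq A) :
    congr_closure R u v -> congr_closure R v w -> congr_closure R u w.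

(* [phi] induces an isomorphism from the monoid [< A | R >] onto [S]. *)
Definition monoid_presentation (T : Type) (S : (T -> T) -> Prop)
    (A : Type) (phi : A -> T -> T) (R : seq A -> seq A -> Prop) : Prop :=
  (forall f : T -> T, S f <-> exists w : seq A, weval phi w = f) /\
  (forall u v : seq A, weval phi u = weval phi v <-> congr_closure R u v).

Definition finitely_presented (T : Type) (S : (T -> T) -> Prop) : Prop :=
  exists (A : finType) (phi : A -> T -> T) (R : seq (seq A * seq A)),
    monoid_presentation S phi (fun l r => (l, r) \in R).

(** * The relations of [S_{J_m}] *)

Fixpoint vword (m k : nat) : seq jstate :=
  if k is k'.+1 then f0_ :: nseq (m ^ k - 1) f1_ ++ vword m k' else [:: f0_].

(* [Jrel_e] expresses that the generator [e] denotes the identity element. *)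
Inductive Jrel (m : nat) : seq jstate -> seq jstate -> Prop :=
| Jrel_e : Jrel m [:: e_] [::]
| Jrel_A (k p : nat) : 1 <= p <= m - 1 ->
    Jrel m (f0_ :: nseq (p * m ^ k - 1) f1_ ++ vword m k) (vword m k)
| Jrel_B (k : nat) :
    Jrel m (f0_ :: nseq (m ^ k - 1) f1_ ++ nseq (m ^ k.+1) f1_ ++ vword m k)
           (nseq (m ^ k.+1) f1_ ++ vword m k).

(** * Deterministic multitape Turing machines *)

Inductive move : Type := MLeft | MStay | MRight.

(* The tape alphabet is [option (I + W)]: the blank is [None], [I] is the input
   alphabet and [W] the set of additional working symbols.  A state [q] with
   [tm_halt q = Some b] is halting, with answer [b]. *)
Record tm (I : finType) : Type := TM {
  tm_state : finType;
  tm_work : finType;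
  tm_ntapes : nat; (* one less than the number of tapes *)
  tm_start : tm_state;
  tm_halt : tm_state -> option bool;
  tm_step : tm_state -> {ffun 'I_tm_ntapes.+1 -> option (I + tm_work)} ->
    tm_state * ('I_tm_ntapes.+1 -> option (I + tm_work) * move)
}.

(* A two-way infinite tape: the cells to the left of the head (nearest first),
   the scanned cell and the cells to the right (nearest first); all the cells
   beyond the two lists are blank. *)
Record tape (G : Type) : Type := Tape {
  tleft : seq (option G);
  thead : option G;
  tright : seq (option G)
}.

Definition tape_of (G : Type) (s : seq (option G)) : tape G :=
  Tape [::] (head None s) (behead s).

Definition tape_update (G : Type) (t : tape G) (a : option G * move) : tape G :=
  match a.2 with
  | MLeft =>
      Tape (behead (tleft t)) (head None (tleft t)) (a.1 :: tright t)
  | MStay => Tape (tleft t) a.1 (tright t)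
  | MRight =>
      Tape (a.1 :: tleft t) (head None (tright t)) (behead (tright t))
  end.

Definition tm_config (I : finType) (M : tm I) : Type :=
  (tm_state M * ('I_(tm_ntapes M).+1 -> tape (I + tm_work M)))%type.

Definition tm_init (I : finType) (M : tm I) (s : seq I) : tm_config M :=
  (tm_start M,
   fun i => if i == ord0 then tape_of [seq Some (inl a) | a <- s]
            else tape_of [::]).

Definition tm_next (I : finType) (M : tm I) (c : tm_config M) : tm_config M :=
  if tm_halt c.1 is Some _ then c else
  let a := tm_step c.1 [ffun i => thead (c.2 i)] in
  (a.1, fun i => tape_update (c.2 i) (a.2 i)).

Definition tm_answers (I : finType) (M : tm I) (s : seq I) (t : nat) (b : bool)
    : Prop :=
  tm_halt (iter t (@tm_next I M) (tm_init M s)).1 = Some b.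

(** * Word problem *)

(* The input [(u, v)] is written as [u # v], the separator [#] being [None]. *)
Definition pair_input (A : Type) (u v : seq A) : seq (option A) :=
  map Some u ++ None :: map Some v.

Definition word_problem_in_time (T : Type) (A : finType) (phi : A -> T -> T)
    (time : nat -> nat) : Prop :=
  exists M : tm (option A), forall u v : seq A,
    exists (t : nat) (b : bool),
      [/\ t <= time (size u + size v),
          tm_answers M (pair_input u v) t b &
          b <-> weval phi u = weval phi v].

Definition word_problem_in_quadratic_time (T : Type) (A : finType)
    (phi : A -> T -> T) : Prop :=
  exists C : nat, word_problem_in_time phi (fun n => C * (n ^ 2 + 1)).

(* Main.v *)
From HB Require Import structures.
Require Import Defs.
From mathcomp Require Import all_boot.
From Stdlib Require Import FunctionalExtensionality.
From mathcomp Require Import zify.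

Set Implicit Arguments.
Unset Strict Implicit.
Unset Printing Implicit Defensive.

(** Read an infinite word as an [m]-adic integer, least significant digit first.
    Then [f_1] adds one, and [f_0] adds one and erases the lowest nonzero digit
    of the result.  Natural numbers are dense, so a product is determined by its
    action on them ([weval_wact]).

    The automaton is self-similar: on [m n + r] a word [x] returns
    [m n' + out_letter x r], where [n'] is the value at [n] of the word
    [section x r], which has the same length ([run_section]).  This gives a
    recursive description of equality of two words, read from right to left.  As
    long as the rightmost letters agree and are [f_1], they can be cancelled
    ([run_f1]).  If they are both [f_0], then, since the image of [f_0] is the
    set of multiples of [m], the words are equal exactly when their remainders
    have the same output letter and equal sections at [x_0] ([run_f0]).  In all
    other cases, up to letters [e], the words differ at some [m^N - 1] with [N]
    large.  There a word that starts with [f_0] has a constant value, and one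
    that starts with [f_1] has the value [m^N + c], because the rest of it moves
    [m^N] as it moves [0]; the empty word fixes [m^N - 1].

    The whole theorem rests on this recursion.

    Presentation.  The word [v_k] produces multiples of [m^(k+1)], and on these
    [f_0 f_1^(p m^k - 1)] is the identity, so the relations hold
    ([f0_absorb]).  Conversely each step of the recursion can be imitated by the
    relations: every word ending in [f_0] is equivalent to some
    [f_1^r blowup(w) f_0] with [r < m], where [blowup] is the substitution
    [f_0 -> f_0 f_1^(m-1)], [f_1 -> f_1^m] and [w] is the section
    ([congr_section]); and [blowup] raises the index of the relations by one
    ([blowup_congr]).  Hence equal words are equivalent ([run_eq_congr]).

    No finite presentation.  Count how often, while a word acts on [n], an
    application of [f_0] reads a number whose last [K] digits are all [m - 1]
    ([ticks]).  The relations of index less than [K] preserve this count and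
    [R_A(K, 1)] does not.  A finite presentation, over whatever generators, uses
    only finitely many consequences of the relations, hence preserves the count
    for some [K].

    Word problem.  A section is computed letter by letter and has the length of
    the original word, so a two-tape machine can run the recursion in place.
    Each round takes linear time and uses up one letter [f_0], and sections have
    no more letters [f_0] than the original word ([count_f0_section]); there are
    linearly many rounds ([compare_answers]). *)

Section Jm.

Variables (m : nat) (hm : 1 < m).

Let m_gt0 : 0 < m. Proof. exact: ltnW. Qed.

(** * The action on natural numbers *)

Definition x0 : 'I_m := Ordinal m_gt0.

(** The transformation [f0_] of the numbers, least significant digit first: a
    digit [m - 1] is erased and the erasure passes on to the next digit; any
    other digit is erased and the process stops.  The fuel only has to exceed
    the number, because [n %/ m < n] whenever the erasure passes on. *)
Fixpoint erase (fuel n : nat) : nat :=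
  if fuel is k.+1 then
    if m %| n.+1 then m * erase k (n %/ m) else m * (n %/ m)
  else 0.

Definition act (q : jstate) (n : nat) : nat :=
  match q with e_ => n | f0_ => erase n.+1 n | f1_ => n.+1 end.

Lemma erase_fuel (k l n : nat) : n < k -> n < l -> erase k n = erase l n.
Proof.
elim: k l n => [|k IHk] [|l] n //= nk nl; case: ifP => // mn.
have n_gt0 : 0 < n by case: (posnP n) mn => // ->; rewrite dvdn1; lia.
have lt_q : n %/ m < n by rewrite ltn_Pdiv.
by congr (_ * _); apply: IHk; lia.
Qed.

(** The self-similarity of [J m] on numbers: the last digit [d] is rewritten by
    the output function and the other digits are processed by the next state.
    It makes an induction on digits uniform in the letter. *)
Lemma actE (q : jstate) (x : nat) (d : 'I_m) :
  act q (m * x + d) = m * act (mtrans (J m) q d) x + mout (J m) q d.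
Proof.
have dm := ltn_ord d.
have dvdE : (m %| (m * x + d).+1) = (d.+1 == m).
  rewrite -addnS dvdn_addr ?dvdn_mulr //; apply/idP/eqP => [md|->] //.
  by apply/eqP; rewrite eqn_leq dm dvdn_leq.
have divE : (m * x + d) %/ m = x by rewrite mulnC divnMDl // divn_small ?addn0.
case: q => /=.
- by case: ifP.
- rewrite dvdE divE addn0; case: eqP => // dm1.
  by congr (_ * _); apply: erase_fuel; nia.
- case: (eqVneq d.+1 m) => [dm1|ndm] /=.
    by rewrite dm1 modnn addn0 mulnS; lia.
  by rewrite modn_small ?addnS // ltn_neqAle ndm.
Qed.

(** The list gives the letters in the order in which they act, so that a case
    analysis on it starts with the rightmost factor of the product. *)
Definition run (x : seq jstate) (n : nat) : nat :=
  foldl (fun n q => act q n) n x.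

Definition wact (u : seq jstate) (n : nat) : nat := foldr act n u.

Lemma wact_run u n : wact u n = run (rev u) n.
Proof. by rewrite /run foldl_rev. Qed.

Lemma wact_cons q u n : wact (q :: u) n = act q (wact u n).
Proof. by []. Qed.

Lemma wact_cat u v n : wact (u ++ v) n = wact u (wact v n).
Proof. exact: foldr_cat. Qed.

Lemma wact_f1 k n : wact (nseq k f1_) n = k + n.
Proof. by elim: k => //= k ->. Qed.

(** * Infinite words and natural numbers *)

Fixpoint prefix_value (n : nat) (w : omega 'I_m) : nat :=
  if n is n'.+1 then m * prefix_value n' (fun i => w i.+1) + w 0 else 0.

Definition digits (x : nat) : omega 'I_m :=
  fun i => Ordinal (ltn_pmod (x %/ m ^ i) m_gt0).

Lemma modn_digit (y n : nat) (d : 'I_m) :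
  (m * y + d) %% m ^ n.+1 = m * (y %% m ^ n) + d.
Proof.
rewrite {1}(divn_eq y (m ^ n)) mulnDr mulnCA -expnS -addnA modnMDl.
rewrite modn_small //.
have : y %% m ^ n < m ^ n by rewrite ltn_pmod ?expn_gt0 ?m_gt0.
have := ltn_ord d.
rewrite expnS; nia.
Qed.

Lemma prefix_value_lt (n : nat) (w : omega 'I_m) : prefix_value n w < m ^ n.
Proof.
elim: n w => [//|n IHn] w /=; rewrite expnS.
have := IHn (fun i => w i.+1); have := ltn_ord (w 0); nia.
Qed.

Lemma prefix_value_inj (w w' : omega 'I_m) :
  (forall n, prefix_value n w = prefix_value n w') -> w = w'.
Proof.
move=> eqv; apply: functional_extensionality => i.
have {}eqv : forall n, prefix_value n w = prefix_value n w' by [].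
elim: i w w' eqv => [|i IHi] w w' eqv.
  by have /= := eqv 1; rewrite !muln0 => /ord_inj.
have e0 : w 0 = w' 0 by have /= := eqv 1; rewrite !muln0 => /ord_inj.
apply: (IHi (fun i => w i.+1) (fun i => w' i.+1)) => n.
have /= := eqv n.+1; rewrite e0 => /addIn /eqP.
by rewrite eqn_pmul2l // => /eqP.
Qed.

Lemma prefix_value_digits (n x : nat) : prefix_value n (digits x) = x %% m ^ n.
Proof.
elim: n x => [|n IHn] x /=; first by rewrite modn1.
have -> : (fun i => digits x i.+1) = digits (x %/ m).
  apply: functional_extensionality => i; apply: ord_inj => /=.
  by rewrite expnS divnMA.
rewrite IHn expn0 divn1 -[x %% m]/(Ordinal (ltn_pmod x m_gt0) : nat).
rewrite -modn_digit /=.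
by rewrite mulnC -divn_eq.
Qed.

(** The first [n] letters of the output depend on the first [n] letters of the
    input only, so the action on them is that on numbers modulo [m ^ n]. *)
Lemma prefix_value_Jact (q : jstate) (n : nat) (w : omega 'I_m) :
  prefix_value n (Jact q w) = act q (prefix_value n w) %% m ^ n.
Proof.
elim: n q w => [|n IHn] q w /=; first by rewrite modn1.
have wE : w = ocons (w 0) (fun i => w i.+1).
  by apply: functional_extensionality => -[].
have -> : (fun i => Jact q w i.+1) =
          Jact (mtrans (J m) q (w 0)) (fun i => w i.+1).
  apply: functional_extensionality => i.
  by rewrite {1}wE /Jact maction_cons.
by rewrite IHn actE modn_digit.
Qed.

Lemma act_mod (q : jstate) (n x : nat) :
  act q (x %% m ^ n) %% m ^ n = act q x %% m ^ n.
Proof.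
elim: n q x => [|n IHn] q x; first by rewrite !modn1.
pose d := Ordinal (ltn_pmod x m_gt0).
have -> : x = m * (x %/ m) + d by rewrite mulnC -divn_eq.
by rewrite modn_digit !actE !modn_digit IHn.
Qed.

Lemma prefix_value_weval (u : seq jstate) (n : nat) (w : omega 'I_m) :
  prefix_value n (weval (@Jact m) u w) = wact u (prefix_value n w) %% m ^ n.
Proof.
elim: u => [|q u IHu] /=; first by rewrite modn_small ?prefix_value_lt.
by rewrite prefix_value_Jact IHu act_mod.
Qed.

(** An infinite word is determined by the values of its prefixes, and a number
    by its residue modulo a large power of [m]; hence the natural numbers, a
    dense set of infinite words, suffice to compare two products. *)
Lemma weval_wact (u v : seq jstate) :
  weval (@Jact m) u = weval (@Jact m) v <-> wact u =1 wact v.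
Proof.
split=> [eq_uv n | eq_uv].
  (* Large enough for [n] and both images to be less than [m ^ N]. *)
  pose N := n + wact u n + wact v n.
  have small k : k <= N -> k %% m ^ N = k.
    by move=> kN; rewrite modn_small // (leq_ltn_trans kN) // ltn_expl.
  have := congr1 (fun f => prefix_value N (f (digits n))) eq_uv.
  rewrite /= !prefix_value_weval prefix_value_digits.
  by rewrite (small n) ?(small (wact _ _)) //; rewrite /N; lia.
apply: functional_extensionality => w; apply: prefix_value_inj => n.
by rewrite !prefix_value_weval eq_uv.
Qed.

(** * Soundness of the relations *)

Lemma f0_digit (x d : nat) : d.+1 < m -> act f0_ (m * x + d) = m * x.
Proof.
move=> dm; have := actE f0_ x (Ordinal (ltnW dm)).
by rewrite /= ltn_eqF // addn0.
Qed.

(** The erasure passes through a block of [k] digits [m - 1]. *)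
Lemma f0_block (k x : nat) :
  act f0_ (m ^ k * x + (m ^ k - 1)) = m ^ k * act f0_ x.
Proof.
elim: k x => [|k IHk] x; first by rewrite !mul1n addn0.
have lt_d : m - 1 < m by lia.
have -> : m ^ k.+1 * x + (m ^ k.+1 - 1)
        = m * (m ^ k * x + (m ^ k - 1)) + Ordinal lt_d.
  have := expn_gt0 m k; rewrite m_gt0 /= expnS => /esym.
  by case: (m ^ k) => // l _; nia.
by rewrite actE /= subn1 prednK // eqxx addn0 [X in m * X]IHk expnS mulnA.
Qed.

Lemma f0_dvd (n : nat) : m %| act f0_ n.
Proof.
pose d := Ordinal (ltn_pmod n m_gt0).
have -> : n = m * (n %/ m) + d by rewrite mulnC -divn_eq.
by rewrite actE /= addn0 dvdn_mulr.
Qed.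

(** [v_k] erases the digits at the places [0, ..., k]: once the first [k] of
    them are zero, [m ^ k - 1] sets them all to [m - 1], and the erasure then
    runs through them up to the place [k]. *)
Lemma vword_dvd (k n : nat) : m ^ k.+1 %| wact (vword m k) n.
Proof.
elim: k => [|k IHk]; first by rewrite expn1 f0_dvd.
rewrite /vword -/vword wact_cons wact_cat wact_f1 addnC.
have /dvdnP[z ->] := IHk; rewrite [z * _]mulnC.
by rewrite f0_block [m ^ k.+2]expnSr dvdn_pmul2l ?expn_gt0 ?m_gt0 ?f0_dvd.
Qed.

(** [f_0 f_1^(p m^k - 1)] adds [p m^k] and erases the lowest nonzero digit; when
    the places [0, ..., k] of [y] are zero, that digit is the [p] just written.
    Both families of relations are instances of this. *)
Lemma f0_absorb (k p y : nat) : 0 < p < m -> m ^ k.+1 %| y ->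
  act f0_ (p * m ^ k - 1 + y) = y.
Proof.
case/andP=> p_gt0 lt_pm /dvdnP[z ->].
have -> : p * m ^ k - 1 + z * m ^ k.+1 = m ^ k * (m * z + p.-1) + (m ^ k - 1).
  have l_gt0 : 0 < m ^ k by rewrite expn_gt0 m_gt0.
  case: p p_gt0 lt_pm => // p _ _ /=.
  by rewrite expnS; move: (m ^ k) l_gt0 => l; lia.
by rewrite f0_block f0_digit ?(ltn_predK p_gt0) // mulnA -expnSr mulnC.
Qed.

Lemma Jrel_sound (l r : seq jstate) : Jrel m l r -> wact l =1 wact r.
Proof.
case=> [//|k p pm|k] n.
  rewrite wact_cons wact_cat wact_f1 f0_absorb ?vword_dvd //.
  by lia.
rewrite wact_cons !wact_cat !wact_f1.
by rewrite -{1}[m ^ k]mul1n f0_absorb // dvdn_add ?vword_dvd.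
Qed.

Lemma congr_sound (u v : seq jstate) :
  congr_closure (Jrel m) u v -> wact u =1 wact v.
Proof.
elim=> {u v} [x l r y /Jrel_sound eq_lr|u|u v _ IH|u v w _ IH1 _ IH2] n //.
  by rewrite !wact_cat eq_lr.
by rewrite IH1.
Qed.

(** * Sections and cancellation *)

(** A product of letters is itself a state of a Mealy automaton: when it reads
    the letter [r], it writes [out_letter x r] and becomes [section x r]. *)
Definition out_letter (x : seq jstate) (r : 'I_m) : 'I_m :=
  foldl (fun i q => mout (J m) q i) r x.

Fixpoint section (x : seq jstate) (r : 'I_m) : seq jstate :=
  if x is q :: x' then mtrans (J m) q r :: section x' (mout (J m) q r)
  else [::].

Lemma size_section x r : size (section x r) = size x.
Proof. by elim: x r => //= q x IHx r; rewrite IHx. Qed.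

Lemma run_section x (r : 'I_m) n :
  run x (m * n + r) = m * run (section x r) n + out_letter x r.
Proof. by elim: x r n => //= q x IHx r n; rewrite actE IHx. Qed.

Lemma act_le q n : act q n <= n.+1.
Proof.
case: q => //=.
suff le_erase k : erase k n <= n by apply: leqW; apply: (le_erase n.+1).
elim: k n => //= k IHk n.
have le_n : m * (n %/ m) <= n by rewrite mulnC leq_divM.
case: ifP => // _; apply: leq_trans le_n.
by rewrite leq_pmul2l.
Qed.

(** A digit at a place [N] that the carry or the erasure cannot reach is left
    alone; hence for each [n] every product is injective on the numbers
    [m ^ N + n] with [N] large. *)
Lemma act_shift q N n : n.+1 < m ^ N -> act q (m ^ N + n) = m ^ N + act q n.
Proof.
elim: N q n => [|N IHN] q n ltn; first by rewrite expn0 in ltn; lia.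
pose d := Ordinal (ltn_pmod n m_gt0).
have nE : n = m * (n %/ m) + d by rewrite mulnC -divn_eq.
rewrite nE addnA expnS -mulnDr !actE addnA -mulnDr; congr (m * _ + _).
case: (boolP (d.+1 == m)) => [/eqP dm|ndm]; last by rewrite /= (negPf ndm).
have n1E : n.+1 = m * (n %/ m).+1 by rewrite mulnS; lia.
by apply: IHN; rewrite -(ltn_pmul2l m_gt0) -expnS -n1E.
Qed.

Lemma run_shift x N n :
  n + size x < m ^ N -> run x (m ^ N + n) = m ^ N + run x n.
Proof.
elim: x n => //= q x IHx n lt_n; rewrite act_shift; last by lia.
by apply: IHx; have := act_le q n; lia.
Qed.

(** Cancelling a common [f1_] on the right only gives the equality of two
    products from [1] on; a translation by a power of [m] recovers it at [0]. *)
Lemma eq_run_eventually x y B :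
  (forall n, B <= n -> run x n = run y n) -> run x =1 run y.
Proof.
move=> eqB n.
have [N ltN] : exists N, B + n + size x + size y < m ^ N.
  by eexists; apply: ltn_expl.
by apply: (@addnI (m ^ N)); rewrite -!run_shift ?eqB; lia.
Qed.

Lemma f0_pred_expn N : act f0_ (m ^ N - 1) = 0.
Proof.
have := f0_block N 0; rewrite muln0 add0n => ->.
by have := f0_digit 0 hm; rewrite muln0 add0n => ->; rewrite muln0.
Qed.

(** The points [m ^ N - 1] tell apart the possible first letters: [f0_] sends
    all of them to [0], so the word is constant there, whereas [f1_] moves them
    to [m ^ N], which the rest of the word moves as it moves [0]. *)
Lemma run_f0_pred x N : run (f0_ :: x) (m ^ N - 1) = run x 0.
Proof. by rewrite -[LHS]/(run x (act f0_ _)) f0_pred_expn. Qed.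

Lemma run_f1_pred x N : size x < N ->
  run (f1_ :: x) (m ^ N - 1) = m ^ N + run x 0.
Proof.
move=> ltN; have predE : (m ^ N - 1).+1 = m ^ N + 0.
  by have := expn_gt0 m N; rewrite m_gt0; lia.
rewrite -[LHS]/(run x (m ^ N - 1).+1) predE run_shift // add0n.
exact: ltn_trans ltN (ltn_expl _ hm).
Qed.

Lemma run_nil_f0 x : ~ run [::] =1 run (f0_ :: x).
Proof.
move=> eqx; have [eq0 eq1] := (eqx (m ^ 0 - 1), eqx (m ^ 1 - 1)).
rewrite !run_f0_pred in eq0 eq1; move: eq1; rewrite -eq0 /= expn0 expn1; lia.
Qed.

Lemma run_nil_f1 x : ~ run [::] =1 run (f1_ :: x).
Proof.
move=> eqx; have := eqx (m ^ (size x).+1 - 1).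
rewrite run_f1_pred // -[run [::] _]/(_ - 1).
by have := ltn_expl (size x).+1 hm; lia.
Qed.

Lemma run_f0_f1 x y : ~ run (f0_ :: x) =1 run (f1_ :: y).
Proof.
move=> eqx.
(* For a single [N], [run x 0] could be [m ^ N + run y 0]. *)
have := eqx (m ^ (size y).+1 - 1); have := eqx (m ^ (size y).+2 - 1).
rewrite !run_f0_pred !run_f1_pred // => -> /addIn /eqP.
by rewrite eqn_exp2l // => /eqP; lia.
Qed.

Lemma run_f1 x y : run (f1_ :: x) =1 run (f1_ :: y) <-> run x =1 run y.
Proof.
split=> [eqxy|eqxy n]; last exact: eqxy.
by apply: (@eq_run_eventually x y 1) => -[//|n] _; apply: eqxy.
Qed.

(** The image of [f0_] is the set of multiples of [m], so what follows [f0_] is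
    only ever seen through its section at the letter [x0]. *)
Lemma run_f0 x y : run (f0_ :: x) =1 run (f0_ :: y) <->
  out_letter x x0 = out_letter y x0 /\
  run (section x x0) =1 run (section y x0).
Proof.
split=> [eqxy|[eqo eqs] n].
  have {}eqxy n : m * run (section x x0) n + out_letter x x0
                = m * run (section y x0) n + out_letter y x0.
    have := eqxy (m * n + 0); rewrite -!run_section.
    rewrite -![run (_ :: _) _]/(run _ (act f0_ _)) f0_digit //.
    by rewrite [m * n + x0]addn0.
  have eqo : out_letter x x0 = out_letter y x0.
    apply: ord_inj; have := congr1 (modn^~ m) (eqxy 0).
    by rewrite ![m * _]mulnC !modnMDl !modn_small.
  split=> // n; have := eqxy n.
  by rewrite eqo => /addIn /eqP; rewrite eqn_pmul2l // => /eqP.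
rewrite -![run (_ :: _) _]/(run _ (act f0_ _)).
have /dvdnP[z ->] := f0_dvd n.
by rewrite mulnC -[m * z]addn0 -[0]/(x0 : nat) !run_section eqo eqs.
Qed.

(** * Completeness of the relations *)

Local Notation "u ~ v" := (congr_closure (Jrel m) u v) (at level 70).

Lemma congr_cat x u v y : u ~ v -> x ++ u ++ y ~ x ++ v ++ y.
Proof.
elim=> {u v} [a l r b lr|u|u v _ IH|u v w _ IH1 _ IH2].
- have := @cc_rel _ (Jrel m) (x ++ a) l r (b ++ y) lr.
  by rewrite -!catA.
- exact: cc_refl.
- exact: cc_sym.
- exact: cc_trans IH1 IH2.
Qed.

Lemma congr_catl x u v : u ~ v -> x ++ u ~ x ++ v.
Proof. by move/(congr_cat x [::]); rewrite !cats0. Qed.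

Lemma congr_catr y u v : u ~ v -> u ++ y ~ v ++ y.
Proof. exact: (congr_cat [::] y). Qed.

Lemma congr_rel l r : Jrel m l r -> l ~ r.
Proof. by move/(@cc_rel _ (Jrel m) [::] l r [::]); rewrite /= !cats0. Qed.

(** The endomorphism of the free monoid whose value at [u] acts on the multiples
    of [m] as [u] acts on the quotients.  Followed by a letter [f0_], the images
    of the relations of index [k] are those of index [k + 1]. *)
Definition blowup (u : seq jstate) : seq jstate :=
  flatten [seq match q with
               | e_ => [::]
               | f0_ => f0_ :: nseq (m - 1) f1_
               | f1_ => nseq m f1_
               end | q <- u].

Lemma blowup_cat u v : blowup (u ++ v) = blowup u ++ blowup v.
Proof. by rewrite /blowup map_cat flatten_cat. Qed.

Lemma blowup_f1 k : blowup (nseq k f1_) = nseq (m * k) f1_.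
Proof.
elim: k => [|k IHk]; first by rewrite muln0.
by rewrite mulnS nseqD -IHk.
Qed.

Lemma blowup_f0f1 k : 0 < k ->
  blowup (f0_ :: nseq (k - 1) f1_) = f0_ :: nseq (m * k - 1) f1_.
Proof.
move=> k_gt0; rewrite /blowup /= -/(blowup _) blowup_f1 -nseqD mulnBr muln1.
by congr (_ :: nseq _ _); nia.
Qed.

Lemma blowup_vword k : blowup (vword m k) ++ [:: f0_] = vword m k.+1.
Proof.
elim: k => [|k IHk]; first by rewrite /= expn1 cats0.
rewrite -[vword m k.+1]/((f0_ :: nseq (m ^ k.+1 - 1) f1_) ++ vword m k).
by rewrite blowup_cat -catA IHk blowup_f0f1 ?expn_gt0 ?m_gt0 // -expnS.
Qed.

Lemma f0_absorb_f0 p : 0 < p < m ->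
  f0_ :: nseq (p - 1) f1_ ++ [:: f0_] ~ [:: f0_].
Proof.
move=> pm; have := @Jrel_A m 0 p; rewrite muln1 => A.
by apply: congr_rel; apply: A; lia.
Qed.

(** [blowup w ++ [:: f0_]] only produces multiples of [m], so [f_0 f_1^(p - 1)]
    has no effect after it.  Syntactically, [R_A(0, p)] does this next to a
    letter [f0_]; next to a power of [f1_], [R_B(0)] first brings a letter [f0_]
    forth. *)
Lemma f0_absorb_blowup p w : 0 < p < m ->
  f0_ :: nseq (p - 1) f1_ ++ blowup w ++ [:: f0_] ~ blowup w ++ [:: f0_].
Proof.
elim: w p => [|q w IHw] p pm; first exact: f0_absorb_f0.
case: q; first exact: IHw.
  have := congr_catr (nseq (m - 1) f1_ ++ blowup w ++ [:: f0_])
    (f0_absorb_f0 pm).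
  by rewrite /blowup /= -!catA.
(* With [W = blowup(w) f_0], the induction hypothesis at [p = 1] and [R_B(0)]
   take [f_1^m W] to [f_1^m f_0 W] and on to [f_0 f_1^m f_0 W], where
   [R_A(0, p)] applies. *)
have B : nseq m f1_ ++ [:: f0_] ~ f0_ :: nseq m f1_ ++ [:: f0_].
  by apply: cc_sym; have := congr_rel (Jrel_B m 0); rewrite /= expn1.
have W : nseq m f1_ ++ blowup w ++ [:: f0_]
       ~ nseq m f1_ ++ f0_ :: blowup w ++ [:: f0_].
  apply/congr_catl/cc_sym; exact: (IHw 1).
have C : nseq m f1_ ++ f0_ :: blowup w ++ [:: f0_]
       ~ f0_ :: nseq m f1_ ++ f0_ :: blowup w ++ [:: f0_].
  by have := congr_catr (blowup w ++ [:: f0_]) B; rewrite /= -!catA.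
rewrite /blowup /= -/(blowup w) -catA.
apply: cc_trans (congr_catl (f0_ :: nseq (p - 1) f1_) (cc_trans W C)) _.
apply: cc_trans (cc_sym (cc_trans W C)).
have := congr_catr (nseq m f1_ ++ f0_ :: blowup w ++ [:: f0_])
  (f0_absorb_f0 pm).
by rewrite /= -!catA.
Qed.

Lemma blowup_rel l r :
  Jrel m l r -> blowup l ++ [:: f0_] ~ blowup r ++ [:: f0_].
Proof.
case=> [|k p pm|k]; first exact: cc_refl.
  rewrite -cat_cons blowup_cat -catA blowup_vword blowup_f0f1; last first.
    by rewrite muln_gt0 expn_gt0 m_gt0; lia.
  by rewrite mulnCA -expnS; apply/congr_rel/Jrel_A.
rewrite -cat_cons (blowup_cat (f0_ :: _)) (blowup_cat (nseq (m ^ k.+1) _)).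
rewrite blowup_f0f1 ?expn_gt0 ?m_gt0 // blowup_f1 -!expnS -!catA blowup_vword.
exact/congr_rel/Jrel_B.
Qed.

(** A relation may be applied inside a word, away from the final [f0_] that
    [blowup_rel] requires; [f0_absorb_blowup] with [p = 1] creates an [f0_] at
    the place where it is needed. *)
Lemma blowup_congr u v : u ~ v -> blowup u ++ [:: f0_] ~ blowup v ++ [:: f0_].
Proof.
elim=> {u v} [a l r b lr|u|u v _ IH|u v w _ IH1 _ IH2].
- have push u : blowup (a ++ u ++ b) ++ [:: f0_]
              ~ blowup a ++ (blowup u ++ [:: f0_]) ++ blowup b ++ [:: f0_].
    rewrite !blowup_cat -!catA; do 2! apply: congr_catl.
    by apply: cc_sym; apply: (@f0_absorb_blowup 1).
  apply: cc_trans (push l) _; apply: cc_trans (cc_sym (push r)).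
  exact/congr_cat/blowup_rel.
- exact: cc_refl.
- exact: cc_sym.
- exact: cc_trans IH1 IH2.
Qed.

(** The syntactic counterpart of [actE]: a word [f_1^r blowup(w) f_0] stands for
    a last digit [r] together with a word [w] that acts on the other digits. *)
Lemma section_step q (r : 'I_m) w :
  q :: nseq r f1_ ++ blowup w ++ [:: f0_]
  ~ nseq (mout (J m) q r) f1_ ++ blowup (mtrans (J m) q r :: w) ++ [:: f0_].
Proof.
have rm := ltn_ord r; have bw : blowup (e_ :: w) = blowup w by [].
case: q => /=.
- rewrite if_same bw.
  exact: (congr_catr (nseq r f1_ ++ blowup w ++ [:: f0_])
                     (congr_rel (Jrel_e m))).
- case: eqP => [rm1|/eqP ndm].
    have -> : nat_of_ord r = m - 1 by lia.
    by rewrite /blowup /= -catA; apply: cc_refl.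
  by have := @f0_absorb_blowup r.+1 w; rewrite subn1 bw; apply; lia.
- case: eqP => [rm1|/eqP ndm].
    rewrite rm1 modnn /blowup /= -/(blowup w) -catA -cat_cons.
    by rewrite -[f1_ :: _]/(nseq r.+1 f1_) rm1; apply: cc_refl.
  by rewrite modn_small ?bw; [apply: cc_refl | lia].
Qed.

Lemma congr_section x (r : 'I_m) w :
  rev x ++ nseq r f1_ ++ blowup w ++ [:: f0_]
  ~ nseq (out_letter x r) f1_ ++ blowup (rev (section x r) ++ w) ++ [:: f0_].
Proof.
elim: x r w => [|q x IHx] r w; first exact: cc_refl.
rewrite /= !rev_cons !cat_rcons.
by apply: cc_trans (congr_catl _ (section_step _ _ _)) (IHx _ _).
Qed.

(** Completeness of the relations.  The first letters of [x] and [y] must agree,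
    apart from [e_]; a common [f1_] is cancelled, and after a common [f0_] both
    words are rewritten as [f_1^r blowup(w) f_0], where the transformation
    determines [r] and the action of [w]. *)
Lemma run_eq_congr x y : run x =1 run y -> rev x ~ rev y.
Proof.
have [n] := ubnP (size x + size y).
elim: n x y => // n IHn x y lt_n.
have Re u : rev u ~ rev (e_ :: u).
  rewrite rev_cons -cats1 -{1}[rev u]cats0; apply/congr_catl/cc_sym.
  exact/congr_rel/Jrel_e.
case: x y lt_n => [|[] x] [|[] y] /= lt_n eqxy.
- exact: cc_refl.
- by apply: cc_trans (Re _); apply: IHn => //=; lia.
- by case: (run_nil_f0 eqxy).
- by case: (run_nil_f1 eqxy).
- by apply: cc_trans (cc_sym (Re _)) _; apply: IHn => //=; lia.
- apply: cc_trans (cc_sym (Re _)) _; apply: cc_trans (Re _).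
  by apply: IHn => //=; lia.
- by apply: cc_trans (cc_sym (Re _)) _; apply: IHn => //=; lia.
- by apply: cc_trans (cc_sym (Re _)) _; apply: IHn => //=; lia.
- by case: (run_nil_f0 (fsym eqxy)).
- by apply: cc_trans (Re _); apply: IHn => //=; lia.
- have [eqo eqs] := (run_f0 x y).1 eqxy.
  have := congr_section x x0 [::]; have := congr_section y x0 [::].
  rewrite !cats0 /= !rev_cons -!cats1 eqo => Cy Cx.
  apply: cc_trans Cx _; apply: cc_trans (cc_sym Cy).
  apply/congr_catl/blowup_congr/IHn => //; rewrite !size_section; lia.
- by case: (run_f0_f1 eqxy).
- by case: (run_nil_f1 (fsym eqxy)).
- by apply: cc_trans (Re _); apply: IHn => //=; lia.
- by case: (run_f0_f1 (fsym eqxy)).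
- rewrite !rev_cons -!cats1; apply: congr_catr; apply: IHn; first by lia.
  exact/run_f1.
Qed.

Lemma congr_weval u v :
  weval (@Jact m) u = weval (@Jact m) v <-> congr_closure (Jrel m) u v.
Proof.
rewrite weval_wact; split=> [eq_uv|]; last exact: congr_sound.
rewrite -[u]revK -[v]revK; apply: run_eq_congr => n.
by rewrite -!wact_run.
Qed.

(** * The monoid and its presentation *)

Lemma Jact_e_id : @Jact m e_ = id.
Proof.
apply: functional_extensionality => w.
by apply: (@functional_extensionality nat) => n; rewrite Jact_e.
Qed.

Lemma SJ_weval f : SJ f <-> exists w, weval (@Jact m) w = f.
Proof.
split=> [|[w <-]].
  elim=> [q|{}f g _ [u <-] _ [v <-]]; first by exists [:: q].
  by exists (u ++ v); elim: u => //= q u ->.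
elim: w => [|q w IHw] /=; last by apply: gen_comp => //; apply: gen_base.
by rewrite -Jact_e_id; apply: gen_base.
Qed.

Lemma SJ_monoid : is_monoid_with_identity (@SJ m) (@Jact m e_).
Proof.
rewrite Jact_e_id; split=> [f g|| //]; first exact: gen_comp.
by apply/SJ_weval; exists [::].
Qed.

Lemma SJ_presentation : monoid_presentation (@SJ m) (@Jact m) (Jrel m).
Proof. by split; [apply: SJ_weval | apply: congr_weval]. Qed.

(** * No finite presentation *)

(** The number of times that, while [u] acts on [n], an erasure passes through
    the places [0, ..., K - 1].  Relations of index less than [K] do not change
    it, since they only add or drop erasures that stop earlier. *)
Fixpoint ticks (K : nat) (u : seq jstate) (n : nat) : nat :=
  if u is q :: u' then
    ticks K u' n + ((q == f0_) && (m ^ K %| (wact u' n).+1))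
  else 0.

Lemma ticks_cat K u v n :
  ticks K (u ++ v) n = ticks K v n + ticks K u (wact v n).
Proof. by elim: u => [|q u IHu] /=; rewrite ?addn0 // IHu wact_cat addnA. Qed.

Lemma ticks_f1 K j n : ticks K (nseq j f1_) n = 0.
Proof. by elim: j => //= j ->. Qed.

Definition same_ticks (K : nat) (u v : seq jstate) : Prop :=
  wact u =1 wact v /\ ticks K u =1 ticks K v.

Lemma same_ticks_cat K u u' v v' :
  same_ticks K u u' -> same_ticks K v v' -> same_ticks K (u ++ v) (u' ++ v').
Proof.
move=> [wu tu] [wv tv]; split=> n; first by rewrite !wact_cat wv wu.
by rewrite !ticks_cat wv tv tu.
Qed.

Lemma same_ticks_refl K u : same_ticks K u u.
Proof. by []. Qed.

Lemma same_ticks_sym K u v : same_ticks K u v -> same_ticks K v u.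
Proof. by move=> [w t]; split=> n; rewrite ?w ?t. Qed.

Lemma same_ticks_trans K u v w :
  same_ticks K u v -> same_ticks K v w -> same_ticks K u w.
Proof. by move=> [w1 t1] [w2 t2]; split=> n; rewrite ?w1 ?t1. Qed.

(** The digit at the place [k] of the number that [f0_] reads is [p - 1], not
    [m - 1], so the erasure stops there. *)
Lemma no_tick k K p y : k < K -> 0 < p < m -> m ^ k.+1 %| y ->
  (m ^ K %| (p * m ^ k - 1 + y).+1) = false.
Proof.
move=> kK /andP[p_gt0 pm] yk; apply/negP => /(dvdn_trans (dvdn_exp2l m kK)).
have -> : (p * m ^ k - 1 + y).+1 = p * m ^ k + y.
  by have : 0 < p * m ^ k; [rewrite muln_gt0 expn_gt0 m_gt0 p_gt0 | lia].
rewrite dvdn_addl // expnS dvdn_pmul2r ?expn_gt0 ?m_gt0 // => /(dvdn_leq p_gt0).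
by lia.
Qed.

Lemma Jrel_same_ticks l r : Jrel m l r ->
  exists K0, forall K, K0 <= K -> same_ticks K l r.
Proof.
move=> lr; have wlr := Jrel_sound lr; case: lr wlr => [|k p pm|k] wlr.
- by exists 0 => K _; split.
- exists k.+1 => K kK; split=> // n.
  rewrite /= ticks_cat ticks_f1 wact_cat wact_f1 no_tick ?vword_dvd ?addn0 //.
  by lia.
exists k.+1 => K kK; split=> // n.
rewrite /= !ticks_cat !ticks_f1 !wact_cat !wact_f1 -{1}[m ^ k]mul1n.
by rewrite no_tick ?dvdn_add ?vword_dvd ?addn0 //.
Qed.

Lemma congr_same_ticks u v : congr_closure (Jrel m) u v ->
  exists K0, forall K, K0 <= K -> same_ticks K u v.
Proof.
elim=> {u v} [x l r y lr|u|u v _ [K0 IH]|u v w _ [K1 IH1] _ [K2 IH2]].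
- have [K0 lrK] := Jrel_same_ticks lr; exists K0 => K KK.
  apply: same_ticks_cat; first exact: same_ticks_refl.
  by apply: same_ticks_cat; [exact: lrK | exact: same_ticks_refl].
- by exists 0.
- by exists K0 => K KK; apply/same_ticks_sym/IH.
- exists (maxn K1 K2) => K; rewrite geq_max => /andP[K1K K2K].
  exact: same_ticks_trans (IH1 K K1K) (IH2 K K2K).
Qed.

Lemma relation_A_ticks K :
  ~ same_ticks K (f0_ :: nseq (1 * m ^ K - 1) f1_ ++ vword m K) (vword m K).
Proof.
case=> _ /(_ 0) /=; rewrite ticks_cat ticks_f1 wact_cat wact_f1 mul1n.
have mK : 0 < m ^ K by rewrite expn_gt0 m_gt0.
rewrite -addSn -subSn // subn1 /= dvdn_addr //.
have -> : m ^ K %| wact (vword m K) 0.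
  exact: dvdn_trans (dvdn_exp2l m (leqnSn K)) (vword_dvd _ _).
by lia.
Qed.

(** Finitely many thresholds have a common bound; the finiteness of a
    presentation enters through this. *)
Lemma eventually_all (T : eqType) (s : seq T) (P : nat -> T -> Prop) :
  (forall x, x \in s -> exists K0, forall K, K0 <= K -> P K x) ->
  exists K0, forall K, K0 <= K -> forall x, x \in s -> P K x.
Proof.
elim: s => [|a s IHs] evP; first by exists 0.
have [|K1 P1] := IHs; first by move=> x xs; apply: evP; rewrite inE xs orbT.
have [K2 P2] := evP a (mem_head _ _).
exists (maxn K1 K2) => K; rewrite geq_max => /andP[K1K K2K] x.
by rewrite inE => /predU1P[->|]; [apply: P2 | apply: P1].
Qed.

Lemma weval_flatten (T A B : Type) (phi : A -> T -> T) (psi : B -> T -> T)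
    (s : A -> seq B) (w : seq A) :
  (forall a, weval psi (s a) = phi a) ->
  weval psi (flatten (map s w)) = weval phi w.
Proof.
move=> sE; elim: w => //= a w <-; rewrite -sE.
by elim: (s a) => //= b t ->.
Qed.

(** Translate a finite presentation over other generators back to [jstate].  The
    finitely many relations, and the finitely many identities that express each
    generator through the translation and back, hold in [S_{J_m}], so they all
    preserve [ticks K] for one large [K].  Then so does every identity of
    [S_{J_m}], contrary to [relation_A_ticks]. *)
Lemma SJ_not_finitely_presented : ~ finitely_presented (@SJ m).
Proof.
case=> A [phi [R [genA presA]]].
have [al alE] : exists al : A -> seq jstate,
    forall a, weval (@Jact m) (al a) = phi a.
  apply: (fin_all_exists (P := fun a w => weval (@Jact m) w = phi a)) => a.
  by apply/SJ_weval/genA; exists [:: a].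
have [be beE] : exists be : jstate -> seq A,
    forall q, weval phi (be q) = Jact q.
  apply: (fin_all_exists (P := fun q w => weval phi w = Jact q)) => q.
  exact/genA/gen_base.
pose als w := flatten (map al w); pose bes u := flatten (map be u).
have alsE w : weval (@Jact m) (als w) = weval phi w by exact: weval_flatten.
have besE u : weval phi (bes u) = weval (@Jact m) u by exact: weval_flatten.
have [K1 RK] : exists K0, forall K, K0 <= K ->
    forall p, p \in R -> same_ticks K (als p.1) (als p.2).
  apply: eventually_all => -[l r] lr; apply/congr_same_ticks/congr_weval.
  rewrite /= !alsE; apply/presA.
  have := @cc_rel _ (fun l r => (l, r) \in R) [::] l r [::] lr.
  by rewrite /= !cats0.
have [K2 bK] : exists K0, forall K, K0 <= K ->
    forall q, q \in enum {: jstate} -> same_ticks K [:: q] (als (be q)).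
  apply: eventually_all => q _; apply/congr_same_ticks/congr_weval.
  by rewrite alsE beE.
pose K := maxn K1 K2.
have {}RK l r : (l, r) \in R -> same_ticks K (als l) (als r).
  by apply: RK; apply: leq_maxl.
have {}bK q : same_ticks K [:: q] (als (be q)).
  by apply: bK; [apply: leq_maxr | rewrite mem_enum].
have als_cat u v : als (u ++ v) = als u ++ als v.
  by rewrite /als map_cat flatten_cat.
have back u : same_ticks K u (als (bes u)).
  elim: u => [|q u IHu]; first exact: same_ticks_refl.
  rewrite -[bes _]/(be q ++ bes u) als_cat.
  exact: same_ticks_cat (bK q) IHu.
have RsK u v : congr_closure (fun l r => (l, r) \in R) u v ->
    same_ticks K (als u) (als v).
  elim=> {u v} [x l r y lr|u|u v _ IH|u v w _ IH1 _ IH2].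
  - by rewrite !als_cat; do 2! [apply: same_ticks_cat => //]; apply: RK.
  - exact: same_ticks_refl.
  - exact: same_ticks_sym.
  - exact: same_ticks_trans IH1 IH2.
apply: (@relation_A_ticks K).
apply: same_ticks_trans (back _) _.
apply: same_ticks_trans (same_ticks_sym (back _)).
apply/RsK/presA; rewrite !besE; apply/congr_weval/congr_rel/Jrel_A; lia.
Qed.

(** * A Turing machine for the word problem *)

(** The machine first brings the words to separate tapes ([Copy], [Seek]).  Then
    it reads them from the right, that is, in the order of [run], and repeats:
    [Compare] cancels letters [f1_] up to the next [f0_], and stops if the words
    disagree or end;
    [Scan r s] replaces what remains of each word by its section, [r] and [s]
    being the letters to be read next; [Return] goes back to the right ends.
    Cancelled letters are overwritten by the neutral [e_]. *)
Inductive phase : Type :=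
  Copy | Seek | Compare | Scan of 'I_m & 'I_m | Return | Halt of bool.

Definition phase_code (p : phase) :
    option (option (option (option (bool + 'I_m * 'I_m)))) :=
  match p with
  | Copy => None
  | Seek => Some None
  | Compare => Some (Some None)
  | Return => Some (Some (Some None))
  | Halt b => Some (Some (Some (Some (inl b))))
  | Scan r s => Some (Some (Some (Some (inr (r, s)))))
  end.

Definition phase_decode
    (c : option (option (option (option (bool + 'I_m * 'I_m))))) : phase :=
  match c with
  | None => Copy
  | Some None => Seek
  | Some (Some None) => Compare
  | Some (Some (Some None)) => Return
  | Some (Some (Some (Some (inl b)))) => Halt b
  | Some (Some (Some (Some (inr (r, s))))) => Scan r s
  end.

Lemma phase_codeK : cancel phase_code phase_decode.
Proof. by case. Qed.

HB.instance Definition _ := Countable.copy phase (can_type phase_codeK).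
HB.instance Definition _ : isFinite phase := CanIsFinite phase_codeK.

Definition cell : Type := option (option jstate + void).

Definition enc (q : jstate) : cell := Some (inl (Some q)).

(** The separator and the blank both count as the end of a word. *)
Definition letter (c : cell) : option jstate :=
  if c is Some (inl o) then o else None.

(** A tape is cut between two cells, [L] and [R] being the halves read away from
    the cut, and the head stands next to the cut, on its left in [ltape] and on
    its right in [rtape].  A move then transfers a cell from one list to the
    other, at the end of a word as well as inside. *)
Definition ltape (L R : seq cell) : tape (option jstate + void) :=
  Tape (behead L) (head None L) R.

Definition rtape (L R : seq cell) : tape (option jstate + void) :=
  Tape L (head None R) (behead R).

Definition scan (r : 'I_m) (c : cell) : 'I_m * (cell * move) :=
  if letter c is Some q then (mout (J m) q r, (enc (mtrans (J m) q r), MLeft))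
  else (r, (c, MStay)).

Definition step (p : phase) (a b : cell)
    : phase * ((cell * move) * (cell * move)) :=
  match p with
  | Copy =>
      if letter a is Some _ then (Copy, ((a, MRight), (a, MRight)))
      else (Seek, ((a, MRight), (b, MStay)))
  | Seek =>
      if letter a is Some _ then (Seek, ((a, MRight), (b, MStay)))
      else (Compare, ((a, MLeft), (b, MLeft)))
  | Compare =>
      match letter a, letter b with
      | Some e_, _ => (Compare, ((a, MLeft), (b, MStay)))
      | _, Some e_ => (Compare, ((a, MStay), (b, MLeft)))
      | Some f1_, Some f1_ => (Compare, ((enc e_, MLeft), (enc e_, MLeft)))
      | Some f0_, Some f0_ => (Scan x0 x0, ((enc e_, MLeft), (enc e_, MLeft)))
      | None, None => (Halt true, ((a, MStay), (b, MStay)))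
      | _, _ => (Halt false, ((a, MStay), (b, MStay)))
      end
  | Scan r s =>
      if letter a || letter b then
        (Scan (scan r a).1 (scan s b).1, ((scan r a).2, (scan s b).2))
      else if r == s then (Return, ((a, MRight), (b, MRight)))
      else (Halt false, ((a, MStay), (b, MStay)))
  | Return =>
      if letter a || letter b then
        (Return, ((a, if letter a then MRight else MStay),
                  (b, if letter b then MRight else MStay)))
      else (Compare, ((a, MLeft), (b, MLeft)))
  | Halt _ => (p, ((a, MStay), (b, MStay)))
  end.

Definition machine : tm (option jstate) :=
  @TM (option jstate) phase void 1 Copy
    (fun p => if p is Halt b then Some b else None)
    (fun p rd => let s := step p (rd ord0) (rd ord_max) in
       (s.1, fun i => if i == ord0 then s.2.1 else s.2.2)).

Definition cfg (p : phase) (t0 t1 : tape (option jstate + void))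
    : tm_config machine :=
  (p, fun i => if i == ord0 then t0 else t1).

Lemma next_cfg p t0 t1 : (if p is Halt _ then false else true) ->
  tm_next (cfg p t0 t1) =
  let s := step p (Defs.thead t0) (Defs.thead t1) in
  cfg s.1 (tape_update t0 s.2.1) (tape_update t1 s.2.2).
Proof.
move=> np; have h : tm_halt (cfg p t0 t1).1 = None by case: p np.
rewrite /tm_next h /= !ffunE /=; congr (_, _).
by apply: functional_extensionality => i; case: ifP.
Qed.

Definition steps (t : nat) (c c' : tm_config machine) : Prop :=
  iter t (@tm_next _ machine) c = c'.

Definition answers (c : tm_config machine) (T : nat) (P : Prop) : Prop :=
  exists t b, [/\ t <= T,
    tm_halt (iter t (@tm_next _ machine) c).1 = Some b & b <-> P].

Lemma steps_cfg t p t0 t1 c : (if p is Halt _ then false else true) ->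
  (let s := step p (Defs.thead t0) (Defs.thead t1) in
   steps t (cfg s.1 (tape_update t0 s.2.1) (tape_update t1 s.2.2)) c) ->
  steps t.+1 (cfg p t0 t1) c.
Proof. by move=> np st; rewrite /steps iterSr next_cfg. Qed.

Lemma answers_steps t c c' T P : t <= T -> steps t c c' ->
  answers c' (T - t) P -> answers c T P.
Proof.
move=> tT cc' [t' [b [t'T ans bP]]].
exists (t' + t), b; split=> //; first by lia.
by rewrite iterD cc'.
Qed.

Lemma answers_cfg p t0 t1 T P :
  0 < T -> (if p is Halt _ then false else true) ->
  (let s := step p (Defs.thead t0) (Defs.thead t1) in
   answers (cfg s.1 (tape_update t0 s.2.1) (tape_update t1 s.2.2)) T.-1 P) ->
  answers (cfg p t0 t1) T P.
Proof.
move=> T0 np; rewrite -subn1; apply: answers_steps => //.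
by rewrite /steps /= next_cfg.
Qed.

Lemma answers_halt (b : bool) t0 t1 T (P : Prop) :
  (b <-> P) -> answers (cfg (Halt b) t0 t1) T P.
Proof. by move=> bP; exists 0, b. Qed.

Lemma answers_iff c T P Q : (P <-> Q) -> answers c T P -> answers c T Q.
Proof.
by move=> PQ [t [b [tT ans bP]]]; exists t, b; split=> //; apply: iff_trans PQ.
Qed.

Lemma run_nseq_e i x n : run (nseq i e_ ++ x) n = run x n.
Proof. by elim: i. Qed.

Lemma count_f0_section x (r : 'I_m) :
  count (pred1 f0_) (section x r) <= count (pred1 f0_) x.
Proof.
elim: x r => //= q x IHx r; apply: leq_add => //.
by case: ifP.
Qed.

(** The heads move independently: the one that is first at the end of its word
    waits there for the other. *)
Lemma scan_steps x y (r s : 'I_m) L L' R R' :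
  letter (head None L) = None -> letter (head None L') = None ->
  exists2 t, t <= size x + size y &
    steps t
      (cfg (Scan r s) (ltape (map enc x ++ L) R) (ltape (map enc y ++ L') R'))
      (cfg (Scan (out_letter x r) (out_letter y s))
         (ltape L (map enc (rev (section x r)) ++ R))
         (ltape L' (map enc (rev (section y s)) ++ R'))).
Proof.
move=> bL bL'; elim: x y r s R R' => [|q x IHx] y r s R R'.
  elim: y s R' => [|q y IHy] s R'; first by exists 0.
  have [t tT st] := IHy (mout (J m) q s) (enc (mtrans (J m) q s) :: R').
  exists t.+1 => //; apply: steps_cfg => //.
  by rewrite /= bL /scan bL /= rev_cons map_rcons cat_rcons.
case: y => [|q' y].
  have [t tT st] := IHx [::] (mout (J m) q r) s
    (enc (mtrans (J m) q r) :: R) R'.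
  exists t.+1 => //; apply: steps_cfg => //.
  by rewrite /= /scan bL' /= rev_cons map_rcons cat_rcons.
have [t tT st] := IHx y (mout (J m) q r) (mout (J m) q' s)
  (enc (mtrans (J m) q r) :: R) (enc (mtrans (J m) q' s) :: R').
exists t.+1; first by rewrite /=; lia.
apply: steps_cfg => //.
by rewrite /= !rev_cons !map_rcons !cat_rcons.
Qed.

Lemma return_steps w w' L L' Z Z' :
  letter (head None Z) = None -> letter (head None Z') = None ->
  exists2 t, t <= size w + size w' &
    steps t
      (cfg Return (rtape L (map enc w ++ Z)) (rtape L' (map enc w' ++ Z')))
      (cfg Return (rtape (map enc (rev w) ++ L) Z)
         (rtape (map enc (rev w') ++ L') Z')).
Proof.
move=> bZ bZ'; elim: w w' L L' => [|q w IHw] w' L L'.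
  elim: w' L' => [|q w' IHw'] L'; first by exists 0.
  have [t tT st] := IHw' (enc q :: L').
  exists t.+1 => //; apply: steps_cfg => //.
  by rewrite /= bZ rev_cons map_rcons cat_rcons.
case: w' => [|q' w'].
  have [t tT st] := IHw [::] (enc q :: L) L'.
  exists t.+1 => //; apply: steps_cfg => //.
  by rewrite /= bZ' rev_cons map_rcons cat_rcons.
have [t tT st] := IHw w' (enc q :: L) (enc q' :: L').
exists t.+1; first by rewrite /=; lia.
apply: steps_cfg => //.
by rewrite /= !rev_cons !map_rcons !cat_rcons.
Qed.

(** The heads have passed [i] and [j] cells, which now all hold [e_], so that
    [N], the total length of the two words on the tapes, never changes.  A full
    round costs less than [3 * N + 5] steps and uses up a letter [f0_] of [x],
    while sections do not create any; this bounds the time. *)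
Lemma compare_answers T N x y i j L L' Z Z' :
  i + size x + (j + size y) = N ->
  size x + size y + count (pred1 f0_) x * (3 * N + 5) < T ->
  letter (head None L) = None -> letter (head None L') = None ->
  letter (head None Z) = None -> letter (head None Z') = None ->
  answers (cfg Compare (ltape (map enc x ++ L) (map enc (nseq i e_) ++ Z))
                       (ltape (map enc y ++ L') (map enc (nseq j e_) ++ Z')))
    T (run x =1 run y).
Proof.
elim/ltn_ind: T x y i j L L' Z Z'.
move=> T IH x y i j L L' Z Z' NE ltT bL bL' bZ bZ'.
have T0 : 0 < T by lia.
apply: answers_cfg => //.
case: x y NE ltT => [|[] x] [|[] y] /= NE ltT; rewrite ?bL ?bL' /=.
- exact: answers_halt.
- by apply: (IH T.-1 _ [::] y i j.+1); rewrite //=; lia.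
- by apply: answers_halt; split=> // /run_nil_f0.
- by apply: answers_halt; split=> // /run_nil_f1.
- by apply: (IH T.-1 _ x [::] i.+1 j); rewrite //=; lia.
- by apply: (IH T.-1 _ x (e_ :: y) i.+1 j); rewrite //=; lia.
- by apply: (IH T.-1 _ x (f0_ :: y) i.+1 j); rewrite //=; lia.
- by apply: (IH T.-1 _ x (f1_ :: y) i.+1 j); rewrite //=; lia.
- by apply: answers_halt; split=> // /fsym /run_nil_f0.
- by apply: (IH T.-1 _ (f0_ :: x) y i j.+1); rewrite //=; lia.
- have [t tT st] := scan_steps x y x0 x0 (map enc (nseq i.+1 e_) ++ Z)
    (map enc (nseq j.+1 e_) ++ Z') bL bL'.
  apply: (answers_steps _ st); first by lia.
  apply: answers_cfg; [by lia | by [] |].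
  rewrite /= bL bL' /=.
  case: (eqVneq (out_letter x x0) (out_letter y x0)) => [eqo|neqo]; last first.
    by apply: answers_halt; split=> // /run_f0[/eqP]; rewrite (negPf neqo).
  (* The words on the tapes when the heads turn back, left to right: the
     section, then one more [e_] in place of the letter [f0_] just read. *)
  pose W u k := rev (section u x0) ++ nseq k.+1 e_.
  have szW u k : size (W u k) = k.+1 + size u.
    by rewrite size_cat size_rev size_nseq size_section addnC.
  have WE u k V : map enc (rev (section u x0)) ++ map enc (nseq k.+1 e_) ++ V
                = map enc (W u k) ++ V.
    by rewrite catA -map_cat.
  have [t' tT' st'] := return_steps (W x i) (W y j)
    (head None L :: behead L) (head None L' :: behead L') bZ bZ'.
  rewrite !szW in tT'; rewrite -!WE in st'.
  apply: (answers_steps _ st'); first by lia.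
  apply: answers_cfg; [by lia | by [] |].
  rewrite /= bZ bZ' /=.
  have revW u k : rev (W u k) = nseq k.+1 e_ ++ section u x0.
    by rewrite rev_cat revK rev_nseq.
  apply: (@answers_iff _ _ (run (rev (W x i)) =1 run (rev (W y j)))).
    rewrite run_f0 !revW; split=> [eqs|[_ eqs] n].
      by split=> // n; have := eqs n; rewrite !run_nseq_e.
    by rewrite !run_nseq_e.
  have cW : count (pred1 f0_) (rev (W x i)) * (3 * N + 5)
            <= count (pred1 f0_) x * (3 * N + 5).
    by rewrite leq_mul2r revW count_cat count_nseq count_f0_section orbT.
  rewrite mulnDl mul1n in ltT.
  set T' := _.-1; move: cW ltT; set c' := _ * _; set c := _ * _ => cW ltT.
  have ltT' : N + c' < T' by rewrite /T'; lia.
  apply: (IH T' _ (rev (W x i)) (rev (W y j)) 0 0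
    (head None L :: behead L) (head None L' :: behead L')
    (head None Z :: behead Z) (head None Z' :: behead Z')) => //.
  + by rewrite /T'; lia.
  + by rewrite !size_rev !szW; lia.
  + by apply: leq_ltn_trans ltT'; rewrite leq_add2r !size_rev !szW; lia.
- by apply: answers_halt; split=> // /run_f0_f1.
- by apply: answers_halt; split=> // /fsym /run_nil_f1.
- by apply: (IH T.-1 _ (f1_ :: x) y i j.+1); rewrite //=; lia.
- by apply: answers_halt; split=> // /fsym /run_f0_f1.
- apply: (answers_iff (iff_sym (run_f1 x y))).
  by apply: (IH T.-1 _ x y i.+1 j.+1); rewrite //=; lia.
Qed.

Lemma copy_steps u L L' S :
  steps (size u) (cfg Copy (rtape L (map enc u ++ S)) (rtape L' [::]))
    (cfg Copy (rtape (map enc (rev u) ++ L) S)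
              (rtape (map enc (rev u) ++ L') [::])).
Proof.
elim: u L L' => [//|q u IHu] L L'; apply: steps_cfg => //.
rewrite rev_cons map_rcons !cat_rcons; exact: IHu.
Qed.

Lemma seek_steps v L L' :
  steps (size v) (cfg Seek (rtape L (map enc v)) (rtape L' [::]))
    (cfg Seek (rtape (map enc (rev v) ++ L) [::]) (rtape L' [::])).
Proof.
elim: v L => [//|q v IHv] L; apply: steps_cfg => //.
rewrite rev_cons map_rcons !cat_rcons; exact: IHv.
Qed.

Lemma init_cfg (u v : seq jstate) : tm_init machine (pair_input u v) =
  cfg Copy (rtape [::] (map enc u ++ Some (inl None) :: map enc v))
           (rtape [::] [::]).
Proof.
rewrite /tm_init /pair_input map_cat /= -!map_comp.
by congr (_, _); apply: functional_extensionality => i; case: ifP.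
Qed.

Lemma quadratic_bound n : n + n + n * (3 * n + 5) + 3 <= 10 * (n ^ 2 + 1).
Proof.
have : n <= n * n by case: n => // n; rewrite leq_pmulr.
by rewrite -mulnn; lia.
Qed.

(** On the input tape remains [v], whose left end is marked by the separator;
    the other tape holds [u].  The blanks in the right halves are those written
    when the heads turn back at the right ends. *)
Lemma machine_answers (u v : seq jstate) :
  answers (tm_init machine (pair_input u v)) (10 * ((size u + size v) ^ 2 + 1))
    (weval (@Jact m) u = weval (@Jact m) v).
Proof.
have := quadratic_bound (size u + size v); move: (10 * _) => T.
set n := size u + size v => leT; have nE : n = size u + size v by [].
rewrite init_cfg.
apply: (answers_steps _ (copy_steps u [::] [::] _)); first by lia.
rewrite !cats0.
apply: answers_cfg; [by lia | by [] |].
apply: (answers_steps _ (seek_steps v _ _)); first by lia.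
apply: answers_cfg; [by lia | by [] |].
apply: (answers_iff (iff_sym (weval_wact u v))).
apply: (@answers_iff _ _ (run (rev v) =1 run (rev u))).
  by split=> eqr k; have := eqr k; rewrite -!wact_run.
have := @compare_answers _ n (rev v) (rev u) 0 0
  (Some (inl None) :: map enc (rev u)) [::] [:: None] [:: None].
rewrite /= cats0; apply; rewrite ?size_rev //.
  by rewrite /n addnC.
have cn : count (pred1 f0_) (rev v) * (3 * n + 5) <= n * (3 * n + 5).
  rewrite leq_mul2r; apply/orP; right.
  by rewrite (leq_trans (count_size _ _)) // size_rev leq_addl.
move: cn leT; set c := _ * _; set c' := _ * _ => cn leT; lia.
Qed.

End Jm.

Theorem theorem2p1 (m : nat) (hm : 2 <= m) :
  [/\ is_monoid_with_identity (@SJ m) (@Jact m e_),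
      monoid_presentation (@SJ m) (@Jact m) (Jrel m),
      ~ finitely_presented (@SJ m) &
      word_problem_in_quadratic_time (@Jact m)].
Proof.
split.
- exact: SJ_monoid.
- exact: SJ_presentation.
- exact: SJ_not_finitely_presented.
exists 10, (machine hm) => u v; exact: machine_answers.
Qed.
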